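(* For every integer $n\ge 1$, the $n$-dimensional hypercube $Q_n$ satisfies $\chi_o(Q_n)=2$ if $n$ is odd and $\chi_o(Q_n)=4$ if $n$ is even.
   Context: $Q_n$ is the graph on $\{0,1\}^n$ in which two vectors are adjacent iff they differ in exactly one coordinate. A proper vertex coloring $\varphi$ of a graph $G$ is called an odd coloring if for every non-isolated vertex $x$ of $G$ there is a color $c$ such that the number of neighbors $y\in N(x)$ with $\varphi(y)=c$ is odd. The odd chromatic number $\chi_o(G)$ is the minimum number of colors in an odd coloring of $G$. *)

(* Defs.v *)
From mathcomp Require Import all_boot.

Set Implicit Arguments.
Unset Strict Implicit.
Unset Printing Implicit Defensive.

Record sgraph := SGraph {
  vertex :> finType;
  adj : rel vertex;
  adj_sym : symmetric adj;
  adj_irrefl : irreflexive adj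
}.

Section OddColoring.

Variable G : sgraph.

Definition neighbors (x : G) : {set G} := [set y | adj x y].

Definition isolated (x : G) : bool := neighbors x == set0.

Definition proper_coloring (k : nat) (phi : {ffun G -> 'I_k}) : bool :=
  [forall x, forall y, adj x y ==> (phi x != phi y)].

Definition odd_coloring (k : nat) (phi : {ffun G -> 'I_k}) : bool :=
  proper_coloring phi &&
  [forall x, ~~ isolated x ==>
     [exists c, odd #|[set y in neighbors x | phi y == c]|]].

Definition odd_colorable (k : nat) : bool :=
  [exists phi : {ffun G -> 'I_k}, odd_coloring phi].

Lemma odd_colorable_exists : exists k, odd_colorable k.
Proof.
exists #|G|; apply/existsP; exists [ffun x => enum_rank x].
apply/andP; split.
  apply/forallP=> x; apply/forallP=> y; apply/implyP=> xy.
  rewrite !ffunE (inj_eq enum_rank_inj).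
  by apply: contraTneq xy => ->; rewrite adj_irrefl.
apply/forallP=> x; apply/implyP=> /set0Pn[y xy].
apply/existsP; exists (enum_rank y).
suff -> : [set z in neighbors x |
            [ffun z => enum_rank z] z == enum_rank y] = [set y].
  by rewrite cards1.
apply/setP=> z; rewrite !inE ffunE (inj_eq enum_rank_inj).
by case: eqP => [->|_]; rewrite ?andbF // andbT; move: xy; rewrite inE.
Qed.

Definition odd_chromatic_number : nat := ex_minn odd_colorable_exists.

End OddColoring.

Section Hypercube.

Variable n : nat.

Definition hypercube_adj : rel {ffun 'I_n -> bool} :=
  fun x y => #|[set i | x i != y i]| == 1.

Lemma hypercube_adj_sym : symmetric hypercube_adj.
Proof.
move=> x y; rewrite /hypercube_adj; congr (_ == _).
by apply: eq_card => i; rewrite !inE eq_sym.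
Qed.

Lemma hypercube_adj_irrefl : irreflexive hypercube_adj.
Proof.
move=> x; rewrite /hypercube_adj (_ : [set i | _] = set0) ?cards0 //.
by apply/setP=> i; rewrite !inE eqxx.
Qed.

Definition hypercube : sgraph :=
  SGraph hypercube_adj_sym hypercube_adj_irrefl.

End Hypercube.

(* Main.v *)
Require Import Defs.
From mathcomp Require Import all_boot zify.

(** A proper coloring of the cube with colors in Z/3 lifts to a height function
    with values in the natural numbers that changes by exactly 1 along every
    edge: around a 4-cycle the increments +1 and -1 have an even sum that is
    divisible by 3 and at most 4 in absolute value, hence 0.  At a vertex of
    maximal height all neighbors have height one less, hence the same color;
    if the degree n is even, that vertex violates the odd coloring condition.
    So at least 4 colors are needed for even n.  Coloring by the parity of the
    vertex (n odd), or by the parity and one fixed coordinate (n even), attains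
    the bounds. *)

Lemma odd_chromatic_number_eq (G : sgraph) k :
  odd_colorable G k -> (forall m, odd_colorable G m -> k <= m) ->
  odd_chromatic_number G = k.
Proof.
move=> colk mink; rewrite /odd_chromatic_number.
case: ex_minnP => m colm minm.
by apply/eqP; rewrite eqn_leq minm // mink.
Qed.

Definition flip {n} (k : 'I_n) (x : {ffun 'I_n -> bool}) : {ffun 'I_n -> bool} :=
  [ffun i => x i (+) (i == k)].

Lemma flipK n (k : 'I_n) : involutive (flip k).
Proof. by move=> x; apply/ffunP=> i; rewrite !ffunE -addbA addbb addbF. Qed.

Lemma flipC n (j k : 'I_n) x : flip j (flip k x) = flip k (flip j x).
Proof. by apply/ffunP=> i; rewrite !ffunE addbAC. Qed.

Lemma flip_inj n (x : {ffun 'I_n -> bool}) : injective (flip^~ x).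
Proof.
move=> j k /ffunP/(_ j); rewrite !ffunE eqxx => /addbI /esym.
by move/eqP.
Qed.

Lemma adj_flip n (x : hypercube n) k : adj x (flip k x).
Proof.
rewrite /adj /= /hypercube_adj (_ : [set i | _] = [set k]) ?cards1 //.
by apply/setP=> i; rewrite !inE ffunE; case: (x i); case: (i == k).
Qed.

Lemma adj_flipP n (x y : hypercube n) :
  reflect (exists k, y = flip k x) (adj x y).
Proof.
apply: (iffP idP) => [/cards1P[k /setP xyk]|[k ->]]; last exact: adj_flip.
exists k; apply/ffunP=> i; move: (xyk i); rewrite !inE ffunE => <-.
by case: (x i); case: (y i).
Qed.

(** Neighbors correspond to directions via the injective [flip^~ x], so color counts around a vertex
    become cardinals of sets of coordinates. *)
Lemma card_neighbors_flip n (x : hypercube n) (P : pred (hypercube n)) :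
  #|[set y in neighbors x | P y]| = #|[set k | P (flip k x)]|.
Proof.
rewrite -(card_imset _ (@flip_inj n x)); congr #|pred_of_set _|.
apply/setP=> y; rewrite !inE; apply/andP/imsetP => [[/adj_flipP[k ->] Py]|].
  by exists k; rewrite ?inE.
by case=> k; rewrite inE => Pk ->; rewrite adj_flip.
Qed.

Lemma hypercube_not_isolated n (x : hypercube n) : 0 < n -> ~~ isolated x.
Proof.
by case: n x => // n x _; apply/set0Pn; exists (flip ord0 x); rewrite inE adj_flip.
Qed.

Lemma proper_coloring_flip n k (phi : {ffun hypercube n -> 'I_k}) :
  reflect (forall i x, phi x != phi (flip i x)) (proper_coloring phi).
Proof.
apply: (iffP forallP) => [prop i x | prop x].
  by move/forallP/(_ (flip i x))/implyP: (prop x); apply; apply: adj_flip.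
by apply/forallP=> y; apply/implyP=> /adj_flipP[i ->].
Qed.

Definition parity {n} (x : {ffun 'I_n -> bool}) : bool :=
  \big[addb/false]_i x i.

Lemma parity_flip n (k : 'I_n) x : parity (flip k x) = ~~ parity x.
Proof.
rewrite /parity (eq_bigr (fun i => x i (+) (i == k))); last by move=> i; rewrite ffunE.
rewrite big_split /= [X in _ (+) X](bigD1 k) //= eqxx [X in true (+) X]big1 ?addbF ?addbT //.
by move=> i /negbTE.
Qed.

Lemma hypercube_odd_2colorable n : odd n -> odd_colorable (hypercube n) 2.
Proof.
move=> odd_n; pose col (b : bool) : 'I_2 := inord b.
have col_inj : injective col.
  by move=> [] [] // /(congr1 val); rewrite /= !inordK.
apply/existsP; exists [ffun x => col (parity x)]; apply/andP; split.
  apply/proper_coloring_flip => i x.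
  by rewrite !ffunE (inj_eq col_inj) parity_flip; case: parity.
apply/forallP=> x; apply/implyP=> _; apply/existsP; exists (col (~~ parity x)).
rewrite card_neighbors_flip (_ : [set k | _] = setT) ?cardsT ?card_ord //.
by apply/setP=> k; rewrite !inE ffunE parity_flip eqxx.
Qed.

Lemma hypercube_even_4colorable n :
  0 < n -> ~~ odd n -> odd_colorable (hypercube n) 4.
Proof.
case: n => // n _; rewrite /= negbK => odd_n.
pose col (b : bool * bool) : 'I_4 := inord (b.1 + b.2.*2).
have col_inj : injective col.
  by move=> [[] []] [[] []] // /(congr1 val); rewrite /= !inordK.
apply/existsP; exists [ffun x : hypercube n.+1 => col (parity x, x ord0)].
apply/andP; split.
  apply/proper_coloring_flip => i x.
  by rewrite !ffunE (inj_eq col_inj) parity_flip xpair_eqE; case: parity.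
apply/forallP=> x; apply/implyP=> _; apply/existsP.
(* Seen along every direction except [ord0]; the dimension is now [n.+1], so this color occurs [n]
   times, an odd number. *)
exists (col (~~ parity x, x ord0)).
rewrite card_neighbors_flip (_ : [set k | _] = [set~ ord0]).
  by rewrite cardsC1 card_ord.
apply/setP=> k; rewrite !inE ffunE (inj_eq col_inj) parity_flip xpair_eqE eqxx /=.
by rewrite ffunE [ord0 == k]eq_sym; case: (x ord0); case: (k == ord0).
Qed.

(** The lift is built one direction at a time, starting from [c] itself: heights on one face of the
    new direction are carried to the opposite face with the increment +1 or -1 that [c] forces
    modulo 3. *)
Lemma hypercube_lift n (c : {ffun 'I_n -> bool} -> nat) :
  (forall i x, c x != c (flip i x) %[mod 3]) ->
  exists h : {ffun 'I_n -> bool} -> nat,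
    (forall x, h x = c x %[mod 3]) /\
    (forall i x, h (flip i x) = (h x).+1 \/ h x = (h (flip i x)).+1).
Proof.
move=> c_proper.
suff /(_ n (leqnn n)) [h [hc hstep]] : forall m, m <= n ->
    exists h : {ffun 'I_n -> bool} -> nat,
    (forall x, h x = c x %[mod 3]) /\
    (forall i : 'I_n, i < m ->
     forall x, h (flip i x) = (h x).+1 \/ h x = (h (flip i x)).+1).
  by exists h; split=> // i; apply: hstep.
elim=> [|m IHm] lt_mn; first by exists c; split.
have [h [hc hstep]] := IHm (ltnW lt_mn).
pose k := Ordinal lt_mn.
(* The shift by 3 keeps the heights on the face [x k = true] natural. *)
pose g (x : {ffun 'I_n -> bool}) := if x k
  then h (flip k x) + (if c x == (c (flip k x)).+1 %[mod 3] then 4 else 2)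
  else h x + 3.
have flipkk (x : {ffun 'I_n -> bool}) : flip k x k = ~~ x k by rewrite ffunE eqxx addbT.
have gc x : g x = c x %[mod 3].
  rewrite /g; case: (x k); last by have := hc x; lia.
  (* Across direction [k] the values of [c] differ by 1 or -1 modulo 3, the residues of 4 and 2. *)
  have := hc (flip k x); have := c_proper k x.
  by case: ifP => /eqP; lia.
exists g; split=> // i; rewrite ltnS leq_eqVlt => /predU1P[im|lt_im] x.
  have -> : i = k by apply: val_inj.
  rewrite /g flipkk flipK.
  by case: (x k) => /=; case: ifP => _; lia.
have nik : k == i = false by apply/eqP=> ki; move: lt_im; rewrite -ki ltnn.
have xik : flip i x k = x k by rewrite ffunE nik addbF.
have gx := gc x; have gix := gc (flip i x); have cx := c_proper i x.
move: gx gix; rewrite /g xik; case: (x k).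
  (* The 4-cycle argument: a unit step of [h] is altered by -2, 0 or 2, so it stays odd and at most
     3 in absolute value; [cx] excludes 3 and -3. *)
  rewrite [flip k (flip i x)]flipC.
  by have := hstep i lt_im (flip k x); do 2![case: ifP => _]; lia.
by have := hstep i lt_im x; lia.
Qed.

Lemma hypercube_even_colors n m :
  0 < n -> ~~ odd n -> odd_colorable (hypercube n) m -> 3 < m.
Proof.
move=> n_gt0 even_n /existsP[phi /andP[/proper_coloring_flip prop odd_phi]].
rewrite ltnNge; apply/negP=> m_le3.
(* Each color is its own residue modulo 3, so properness gives the hypothesis of the lift and
   congruent colors are equal. *)
have phi_lt3 x : phi x < 3 by apply: leq_trans m_le3.
have [i x|h [hc hstep]] := @hypercube_lift n (fun x => phi x).
  by rewrite !modn_small // prop.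
pose x0 : hypercube n := [ffun=> false].
have [x _ hmax] := @arg_maxnP _ x0 xpredT h isT.
have phi_flip i j : phi (flip i x) = phi (flip j x).
  apply: val_inj; have := hc (flip i x); have := hc (flip j x).
  have := phi_lt3 (flip i x); have := phi_lt3 (flip j x).
  have := hmax (flip i x) isT; have := hmax (flip j x) isT.
  by have := hstep i x; have := hstep j x; move=> /=; lia.
move/forallP/(_ x): odd_phi; rewrite hypercube_not_isolated //=.
case/existsP=> c; rewrite card_neighbors_flip.
pose i0 := Ordinal n_gt0.
(* Every color occurs [n] or 0 times around [x], both even. *)
have -> : [set k | phi (flip k x) == c] = if phi (flip i0 x) == c then setT else set0.
  by apply/setP=> k; rewrite inE (phi_flip k i0); case: ifP; rewrite inE.
by case: ifP => _; rewrite ?cards0 // cardsT card_ord (negbTE even_n).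
Qed.

Lemma hypercube_colors n m : 0 < n -> odd_colorable (hypercube n) m -> 1 < m.
Proof.
move=> n_gt0 /existsP[phi /andP[/proper_coloring_flip prop _]].
have := prop (Ordinal n_gt0) [ffun=> false].
(* ['I_0] has no color to give, and a single color agrees at both ends of an edge. *)
case: m phi {prop} => [|[|m]] // phi; first by case: (phi [ffun=> false]).
by rewrite !ord1.
Qed.

Theorem theorem1 (n : nat) (hn : 1 <= n) :
  odd_chromatic_number (hypercube n) = if odd n then 2 else 4.
Proof.
case: ifPn => odd_n; apply: odd_chromatic_number_eq => [|m].
- exact: hypercube_odd_2colorable.
- exact: hypercube_colors.
- exact: hypercube_even_4colorable.
- exact: hypercube_even_colors.
Qed.
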